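(* Let $a$, $b$, $c$ be positive rational numbers and write $abc=R^2S$ where $R$ is a rational number and $S$ is a square-free integer. Let $d_1,d_2,d_3$ be the positive integers attached to $(a,b,c)$ as defined in the context. Then every integer congruent to $-S$ modulo $8d_1d_2d_3S^2$ is not represented by $ax^2+by^2+cz^2$ over the rational numbers. In particular, if $a$, $b$, $c$ are positive integers, then any integer congruent to $-S$ modulo $8abcS$ is not represented by $ax^2+by^2+cz^2$ over the rational numbers, and more particularly any integer congruent to $-abc$ modulo $8(abc)^2$ is not represented by $ax^2+by^2+cz^2$ over the rational numbers.
   Context: A number $N$ is represented by $ax^2+by^2+cz^2$ over the rational numbers if there exist $x,y,z\in\mathbb{Q}$ with $ax^2+by^2+cz^2=N$. Definition of $d_1,d_2,d_3$: write $a=r^2a_1$, $b=s^2b_1$, $c=t^2c_1$ with $a_1,b_1,c_1$ square-free integers and $r,s,t$ rational numbers. Let $d=\gcd(a_1,b_1,c_1)$ and write $a_1=da_2$, $b_1=db_2$, $c_1=dc_2$. Then $d_1=\gcd(a_2,b_2)$, $d_2=\gcd(a_2,c_2)$ and $d_3=\gcd(b_2,c_2)$. *)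

(* Defs.v *)
From mathcomp Require Import all_boot all_order all_algebra.

Set Implicit Arguments.
Unset Strict Implicit.
Unset Printing Implicit Defensive.

Import Order.TTheory GRing.Theory Num.Theory.
Local Open Scope ring_scope.

(* 0 is excluded, since every k ^+ 2 divides it. *)
Definition squarefreez (n : int) : Prop :=
  forall k : int, (k ^+ 2 %| n)%Z -> k \is a GRing.unit.

Definition represented (a b c N : rat) : Prop :=
  exists x y z : rat, a * x ^+ 2 + b * y ^+ 2 + c * z ^+ 2 = N.

(* (d1, d2, d3) is the triple attached to (a, b, c).  For nonzero a, b, c the
   square-free parts a1, b1, c1 are unique, hence so are d1, d2, d3; [gcdz] is
   the nonnegative gcd. *)
Definition attached_gcds (a b c : rat) (d1 d2 d3 : int) : Prop :=
  exists (r s t : rat) (a1 b1 c1 a2 b2 c2 : int),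
    let d := gcdz (gcdz a1 b1) c1 in
    [/\ [/\ squarefreez a1, squarefreez b1 & squarefreez c1],
        [/\ a = r ^+ 2 * a1%:Q, b = s ^+ 2 * b1%:Q & c = t ^+ 2 * c1%:Q],
        [/\ a1 = d * a2, b1 = d * b2 & c1 = d * c2]
      & [/\ d1 = gcdz a2 b2, d2 = gcdz a2 c2 & d3 = gcdz b2 c2]].

(* Main.v *)
Require Import Defs.
From mathcomp Require Import all_boot all_order all_algebra.
From mathcomp Require Import zify ring.

(** In all three cases one gets a representation of [abc * v * n ^ 2] by
    [f = a x^2 + b y^2 + c z^2] with integers [a, b, c, v > 0] such that
    [v = 7 mod 8] and [v = -1] modulo every prime dividing [abc].  Let [X] be the
    representing vector, [Y] a vector whose inner product [h] with [X] is the
    generator of the ideal of all such inner products, and [Z = X x Y].  With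
    [g = bc P^2 + ac Q^2 + ab R^2], Lagrange's identity [g(Z) = f(X) f(Y) - h^2]
    shows that [- g(Z)] is a unit square modulo [v], so that the Jacobi symbol
    [(g(Z) / v)] is [-1].  On the other hand [g] restricted to the orthogonal of
    [X] is a binary form of determinant [v] up to squares, so [- v] is a square
    modulo every prime factor [q] of the value of [g] at the primitive multiple
    of [Z] (for [q] dividing [abc] because [v = -1] modulo [q]); by quadratic
    reciprocity [(q / v) = 1] for each of them, and
    [(g(Z) / v) = 1], a contradiction. *)

Set Implicit Arguments.
Unset Strict Implicit.
Unset Printing Implicit Defensive.

Import Order.TTheory GRing.Theory Num.Theory.

(** * The Jacobi symbol *)

(* The sign of [x] modulo the odd number [n]: [false] and [true] stand for the
   residues in [1, n/2] and [-n/2, -1]. *)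
Definition sgnb (n x : nat) : bool := (n./2 < x %% n)%N.
(* By Gauss's lemma, generalised by Schering to composite moduli, this is the
   exponent of the Jacobi symbol [(a / n) = (-1) ^ jac n a] for [n] odd and
   [a] coprime to [n]. *)
Definition jac (n a : nat) : bool := \big[addb/false]_(j < n./2) sgnb n (a * j.+1).

Lemma sgnb_mod n x y : x = y %[mod n] -> sgnb n x = sgnb n y.
Proof. by rewrite /sgnb => ->. Qed.

Lemma jac_mod n a b : a = b %[mod n] -> jac n a = jac n b.
Proof.
by move=> eq_ab; apply: eq_bigr => j _; apply: sgnb_mod; rewrite -modnMml eq_ab modnMml.
Qed.

Lemma sgnbN n x y : odd n -> ~~ (n %| x) -> n %| x + y -> sgnb n y = ~~ sgnb n x.
Proof.
move=> n_odd nx /dvdnP [k xy]; rewrite /sgnb.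
have n_gt0 : 0 < n by case: n n_odd {nx xy}.
have ? := ltn_pmod x n_gt0; have ? := ltn_pmod y n_gt0.
move: nx; rewrite /dvdn => nx.
have: n %| x %% n + y %% n by rewrite /dvdn modnDm xy modnMl.
move=> /dvdnP [[|[|l]] E].
- by lia.
- by lia.
- by have: 2 * n <= l.+2 * n; [rewrite leq_mul2r orbT | lia].
Qed.

(** * Gauss's lemma: multiplication by [b] on the half-system *)

Section Fold.
Variables (n b : nat).
Hypotheses (n_odd : odd n) (co_bn : coprime n b).

Let n_gt0 : 0 < n. Proof. by case: n n_odd. Qed.

Let r (j : nat) := (b * j.+1) %% n.

(* Minus one because [j : 'I_(n./2)] encodes the half-system element [j.+1]. *)
Definition foldn (j : nat) := (if n./2 < r j then n - r j else r j).-1.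

Let ndvd (j : nat) : j < n./2 -> ~~ (n %| b * j.+1).
Proof.
move=> jn; rewrite Gauss_dvdr //; apply/negP => /dvdn_leq; lia.
Qed.

Let r_gt0 j : j < n./2 -> 0 < r j.
Proof. by move=> /ndvd; rewrite lt0n. Qed.

Let r_lt j : r j < n. Proof. exact: ltn_pmod. Qed.

Lemma foldn_lt (j : 'I_(n./2)) : foldn j < n./2.
Proof.
have := r_gt0 (ltn_ord j); have := r_lt j; have := ltn_ord j.
by rewrite /foldn; case: ifP; lia.
Qed.

Definition foldo (j : 'I_(n./2)) : 'I_(n./2) := Ordinal (foldn_lt j).

Lemma foldoE (j : 'I_(n./2)) :
  (foldo j).+1 = if sgnb n (b * j.+1) then n - r j else r j.
Proof.
have := r_gt0 (ltn_ord j); have := r_lt j.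
by rewrite /= /foldn /sgnb -/(r j); case: ifP; lia.
Qed.

(** If two residues agree up to sign, [n] divides [b * (j - i)] or [b * (i.+1 + j.+1)]; as [b] is
    prime to [n], the sizes leave only [i = j]. *)
Lemma foldo_inj : injective foldo.
Proof.
have main (i j : 'I_(n./2)) : i <= j -> foldo i = foldo j -> i = j.
  move=> le_ij /(congr1 (fun k : 'I__ => k.+1)); rewrite !foldoE.
  have := ltn_ord i; have := ltn_ord j => jn In.
  have [ri rj] := (r_lt i, r_lt j).
  have same : r i = r j -> i = j.
    move=> E; apply/val_inj/eqP; rewrite eqn_leq le_ij /=.
    have : n %| b * (j - i).
      have -> : b * (j - i) = b * j.+1 - b * i.+1 by rewrite -mulnBr subSS.
      by rewrite -eqn_mod_dvd ?leq_mul2l ?ltnS ?le_ij ?orbT //; apply/eqP.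
    rewrite Gauss_dvdr // => D; rewrite leqNgt; apply/negP => lt_ij.
    by have := dvdn_leq _ D; lia.
  have opp : r i + r j = n -> i = j.
    move=> E; have : n %| b * (i.+1 + j.+1).
      by rewrite mulnDr /dvdn -modnDm -/(r i) -/(r j) E modnn.
    by rewrite Gauss_dvdr // => /dvdn_leq; lia.
  by case: ifP => _; case: ifP => _ E;
    [apply: same | apply: opp | apply: opp | apply: same]; lia.
by move=> i j E; case: (leqP i j) => [/main|/ltnW/main H]; [exact | exact/esym/H].
Qed.

(** Modulo [n], [b * j.+1] is plus or minus [(foldo j).+1], with sign [sgnb n (b * j.+1)];
    multiplication by [a] carries that sign along. *)
Lemma foldo_sgn a (j : 'I_(n./2)) : coprime n a ->
  sgnb n (a * b * j.+1) = sgnb n (b * j.+1) (+) sgnb n (a * (foldo j).+1).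
Proof.
move=> co_an; have Ea : a * b * j.+1 = a * r j %[mod n].
  by rewrite -mulnA -modnMmr.
have rn := r_lt j.
rewrite foldoE; case: (boolP (sgnb n (b * j.+1))) => _; last exact: sgnb_mod.
rewrite (sgnb_mod Ea) (@sgnbN n (a * r j) (a * (n - r j))) ?addTb ?negbK //.
- by rewrite Gauss_dvdr // /dvdn modn_mod ndvd.
- by rewrite -mulnDr subnKC ?dvdn_mull // ltnW.
Qed.

(** Sum [foldo_sgn] over [j]: the injective [foldo] permutes the half-system, which turns one of the
    two sums into [jac n a]. *)
Lemma jacM a : coprime n a -> jac n (a * b) = jac n a (+) jac n b.
Proof.
move=> co_an; rewrite /jac [X in _ = X (+) _](reindex_inj foldo_inj) addbC -big_split /=.
by apply: eq_bigr => j _; rewrite foldo_sgn.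
Qed.

(** Eisenstein's form of Gauss's lemma: take parities in the division of [b * j.+1] by [n]. The
    parities of [j.+1] and of [(foldo j).+1] have the same sum and cancel. *)
Lemma jac_floor : odd b ->
  jac n b = odd (\sum_(j < n./2) (b * j.+1) %/ n).
Proof.
move=> b_odd; rewrite (big_morph odd oddD (erefl _)).
have oddE (j : 'I_(n./2)) :
    odd ((b * j.+1) %/ n) = odd j.+1 (+) (sgnb n (b * j.+1) (+) odd (foldo j).+1).
  have : odd (b * j.+1) = odd ((b * j.+1) %/ n * n + r j) by rewrite -divn_eq.
  rewrite oddD !oddM n_odd b_odd andbT andTb => ->; rewrite foldoE.
  case: ifP; rewrite ?oddB ?n_odd ?(ltnW (r_lt j)) //=;
  by case: (odd _); case: (odd _).
rewrite (eq_bigr _ (fun j _ => oddE j)) big_split /= big_split /=.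
by rewrite [X in X (+) _](reindex_inj foldo_inj) /= addbCA addbb addbF.
Qed.

End Fold.

(** * Supplementary laws and quadratic reciprocity *)

Lemma jac_square n a : odd n -> coprime n a -> jac n (a ^ 2) = false.
Proof. by move=> ? ?; rewrite expnS expn1 jacM ?addbb. Qed.

Lemma jac_pred n : odd n -> jac n n.-1 = odd n./2.
Proof.
move=> n_odd; rewrite /jac (eq_bigr (fun=> true)) => [|j _].
  rewrite big_const_ord; elim: (n./2) => //= k ->; exact: addTb.
have jn := ltn_ord j.
have n1 : 0 < n by lia.
rewrite (@sgnbN n j.+1 (n.-1 * j.+1)) //.
- by rewrite /sgnb modn_small; lia.
- by apply/negP => /dvdn_leq; lia.
- by rewrite -[X in X + _]mul1n -mulnDl add1n prednK ?dvdn_mulr.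
Qed.

(** Only the [j] from [n./2./2] on contribute; for [n = 8 k + 7] there are [2 k + 2] of them. *)
Lemma jac_two n : n %% 8 = 7 -> jac n 2 = false.
Proof.
move=> n7; have -> : jac n 2 = odd (\sum_(0 <= j < n./2) (n./2 <= j.*2.+1)).
  rewrite (big_morph odd oddD (erefl _)) big_mkord; apply: eq_bigr => j _.
  have jn := ltn_ord j.
  rewrite /sgnb modn_small ?oddb; first by congr (_ : bool); lia.
  lia.
rewrite (@big_cat_nat _ _ _ (n./2./2)) //=; try lia.
rewrite big_nat big1 ?add0n => [|j]; last by lia.
rewrite big_nat (eq_bigr (fun=> 1)) => [|j]; last by lia.
rewrite -big_nat sum_nat_const_nat; lia.
Qed.

Lemma floor_count n m (j : nat) : odd n -> odd m -> j < n./2 ->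
  (m * j.+1) %/ n = \sum_(i < m./2) (n * i.+1 <= m * j.+1).
Proof.
move=> n_odd m_odd jn; set q := _ %/ _.
have n_gt0 : 0 < n by lia.
have qm : q <= m./2.
  have : q * n <= m * j.+1 by exact: leq_divM.
  nia.
rewrite -(big_mkord xpredT (fun i => nat_of_bool (n * i.+1 <= m * j.+1))).
rewrite (@big_cat_nat _ _ _ q) //=.
rewrite [X in _ + X]big_nat [X in _ + X]big1 => [|i /andP[qi _]].
  rewrite addn0 big_nat (eq_bigr (fun=> 1)) => [|i /andP[_ iq]].
    by rewrite -big_nat sum_nat_const_nat; lia.
  by rewrite mulnC -leq_divRL // iq.
by rewrite mulnC -leq_divRL // leqNgt ltnS qi.
Qed.

(** Eisenstein's lattice count: each point of the [n./2] by [m./2] rectangle lies on one side of the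
    line [n * i = m * j], and coprimality keeps the points off that line. *)
Lemma jac_reciprocity n m : odd n -> odd m -> coprime n m ->
  jac n m (+) jac m n = odd (n./2 * m./2).
Proof.
move=> n_odd m_odd co; rewrite !jac_floor // 1?coprime_sym // -oddD; congr odd.
rewrite (eq_bigr _ (fun j _ => floor_count n_odd m_odd (ltn_ord j))).
rewrite (eq_bigr _ (fun j _ => floor_count m_odd n_odd (ltn_ord j))).
rewrite [X in _ + X]exchange_big -big_split /=.
rewrite -[in RHS](card_ord n./2) -[in RHS](card_ord m./2) -sum_nat_const.
apply: eq_bigr => j _; rewrite -big_split /= -[RHS]muln1 -sum_nat_const.
apply: eq_bigr => i _; case: (ltngtP (n * i.+1)) => // E.
have : n %| j.+1 by rewrite -(Gauss_dvdr _ co) -E dvdn_mulr.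
by move=> /dvdn_leq; have := ltn_ord j; lia.
Qed.

(** For [q] prime: [- v] is a square modulo [q], namely that of [U / W]. The fraction avoids
    inverses modulo [q]. *)
Definition neg_square (v q : nat) : Prop :=
  exists U W : nat, ~~ (q %| W) /\ (q %| U ^ 2 + v * W ^ 2).

(** For [q] odd, [(- v / q) = 1] gives [(v / q) = (-1 / q)], and reciprocity with [v = 3 mod 4]
    turns this into [(q / v) = 1]. *)
Lemma jac_prime_false v q : v %% 8 = 7 -> prime q -> ~~ (q %| v) ->
  neg_square v q -> jac v q = false.
Proof.
move=> v7 q_pr qv [U [W [qW D]]].
have [v_odd v2_odd] : odd v /\ odd v./2 by lia.
have [q_odd|q_even] := boolP (odd q); last first.
  by case: (even_prime q_pr) q_even => [->|->//] _; exact: jac_two.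
have co k : ~~ (q %| k) -> coprime q k by rewrite prime_coprime.
have q_gt0 := prime_gt0 q_pr.
have qU : ~~ (q %| U).
  apply/negP => qU; move: D.
  by rewrite dvdn_addr ?dvdn_exp // Gauss_dvdr ?co // Euclid_dvdX // (negbTE qW).
have qpred : ~~ (q %| q.-1) by rewrite -prime_coprime // coprimenP.
(* [q.-1] stands for [-1] in the natural numbers. *)
have E : U ^ 2 = v * q.-1 * W ^ 2 %[mod q].
  apply/eqP; rewrite -(eqn_modDr (v * W ^ 2)) -mulnDl.
  have -> : v * q.-1 + v = q * v by rewrite mulnC -mulSnr prednK.
  by rewrite -mulnA modnMr.
have := jac_mod E; rewrite jac_square ?co // jacM ?jac_square ?coprimeXr ?coprimeMr ?co //.
rewrite addbF jacM ?co // jac_pred // => Jv0.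
have Jv : jac q v = odd q./2 by move: Jv0; case: (jac q v); case: (odd _).
have := @jac_reciprocity v q v_odd q_odd; rewrite coprime_sym co // => /(_ isT).
rewrite Jv oddM v2_odd.
by case: (jac v q); case: (odd _).
Qed.

(** The divisibility gives [t] the same symbol as [-1], which is [-1] because [v = 3 mod 4]; yet
    every prime factor of [t] has symbol [1]. *)
Lemma no_negative_square v t k h : v %% 8 = 7 -> 0 < t -> coprime v h ->
  v %| t * k ^ 2 + h ^ 2 ->
  (forall q, prime q -> q %| t -> neg_square v q) ->
  False.
Proof.
move=> v7 t_gt0 co_h D Ht.
have [v_odd v2_odd] : odd v /\ odd v./2 by lia.
have v_gt0 : 0 < v by lia.
have co_tk : coprime v (t * k ^ 2).
  move: D => /dvdnP [m E]; have := coprimeXr 2 co_h.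
  have -> : h ^ 2 = m * v - t * k ^ 2 by rewrite -E addKn.
  set d := t * _ => /eqP C; rewrite /coprime -dvdn1 -{}C dvdn_gcd dvdn_gcdl dvdn_sub //.
    by rewrite dvdn_mull // dvdn_gcdl.
  exact: dvdn_gcdr.
have [co_t co_k] : coprime v t /\ coprime v k.
  by move: co_tk; rewrite coprimeMr coprime_pexpr // => /andP.
have copred : coprime v v.-1 by rewrite coprime_sym coprimePn.
have E : t * k ^ 2 = v.-1 * h ^ 2 %[mod v].
  apply/eqP; rewrite -(eqn_modDr (h ^ 2)) -[X in _ == _ + X %[mod v]]mul1n -mulnDl.
  by rewrite addn1 prednK // modnMr.
have jacMsq i j : coprime v i -> coprime v j -> jac v (i * j ^ 2) = jac v i.
  by move=> ? ?; rewrite jacM ?coprimeXr // jac_square // addbF.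
have := jac_mod E; rewrite !jacMsq // jac_pred //.
rewrite v2_odd.
have: forall s, s %| t -> jac v s = false; last by move->.
elim/ltn_ind=> s IH st.
have [s1|s1] := leqP s 1.
  have -> : s = 1 ^ 2 by have := dvdn_gt0 t_gt0 st; lia.
  by rewrite jac_square ?coprimen1.
have q_pr := pdiv_prime s1; have qs := pdiv_dvd s.
set q := pdiv s in q_pr qs.
have co_s x : x %| s -> coprime v x.
  by move=> xs; apply: coprime_dvdr co_t; apply: dvdn_trans st.
have sq : s %/ q %| s by rewrite -[X in _ %| X](divnK qs) dvdn_mulr.
rewrite -(divnK qs) jacM ?co_s // IH ?ltn_Pdiv ?prime_gt1 ?(ltnW s1) //.
  apply: jac_prime_false => //; last by apply: Ht => //; apply: dvdn_trans st.
  by rewrite -prime_coprime // coprime_sym co_s.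
exact: dvdn_trans st.
Qed.

(** * Ternary forms over the integers *)

Local Open Scope ring_scope.

Lemma Euclidz_dvdM (q : nat) (m n : int) : prime q ->
  (q %| m * n)%Z = (q %| m)%Z || (q %| n)%Z.
Proof. by move=> q_pr; rewrite !dvdzE abszM Euclid_dvdM. Qed.

Lemma Euclidz_dvdX2 (q : nat) (m : int) : prime q -> (q %| m ^+ 2)%Z = (q %| m)%Z.
Proof. by move=> q_pr; rewrite expr2 Euclidz_dvdM // orbb. Qed.

Lemma neg_square_int (v q : nat) (U W : int) :
  ~~ (q %| W)%Z -> (q %| U ^+ 2 + v%:Z * W ^+ 2)%Z -> neg_square v q.
Proof.
rewrite dvdzE => qW D; exists `|U|%N, `|W|%N; split=> //.
suff E : (`|U| ^ 2 + v * `|W| ^ 2)%N = U ^+ 2 + v%:Z * W ^+ 2 :> int.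
  by move: D; rewrite -E.
by rewrite PoszD PoszM -!mulnn !PoszM !abszE -!expr2 !real_normK ?num_real.
Qed.

Lemma orthogonal_complement_dvd (a b c T n x y z P Q R : int) (v q : nat) :
  prime q ->
  a * x ^+ 2 + b * y ^+ 2 + c * z ^+ 2 = a * b * c * (v%:Z * n ^+ 2) ->
  x * P + y * Q + z * R = 0 ->
  b * c * P ^+ 2 + a * c * Q ^+ 2 + a * b * R ^+ 2 = T ->
  (q %| T)%Z -> ~~ (q %| a * b * c)%Z -> ~~ (q %| n)%Z -> ~~ (q %| x)%Z ->
  ~~ (q %| R)%Z -> neg_square v q.
Proof.
move=> q_pr EF Eo ET qT qabc qn qx qR.
(* [x ^+ 2] times the quadratic form [T] restricted to the orthogonal of
   [(x, y, z)] is binary with determinant [v * (a b c x n) ^ 2]; complete the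
   square. *)
pose U := c * (b * y ^+ 2 + a * x ^+ 2) * Q + b * c * y * z * R.
apply: (@neg_square_int v q U (a * b * c * x * n * R)).
  by rewrite !Euclidz_dvdM // !negb_or in qabc *; rewrite qabc qx qn qR.
have -> : U ^+ 2 + v%:Z * (a * b * c * x * n * R) ^+ 2 =
  c * (b * y ^+ 2 + a * x ^+ 2) * x ^+ 2 * T; last exact: dvdz_mull.
have E1 : v%:Z * (a * b * c * x * n * R) ^+ 2 =
  (a * b * c * (v%:Z * n ^+ 2)) * (a * b * c * x ^+ 2 * R ^+ 2) by ring.
have E2 : x ^+ 2 * P ^+ 2 = (y * Q + z * R) ^+ 2.
  have -> : y * Q + z * R = - (x * P).
    by move/eqP: Eo; rewrite -addrA addr_eq0 => /eqP ->; ring.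
  by ring.
rewrite E1 -EF -ET /U.
set k := c * (b * y ^+ 2 + a * x ^+ 2).
have -> : k * x ^+ 2 * (b * c * P ^+ 2 + a * c * Q ^+ 2 + a * b * R ^+ 2) =
    k * (b * c * (x ^+ 2 * P ^+ 2) + x ^+ 2 * (a * c * Q ^+ 2 + a * b * R ^+ 2)).
  by ring.
by rewrite E2 /k; ring.
Qed.

(** If [q] divides [R] but not [Q], exchange the last two coordinates; if it divides both,
    orthogonality makes it divide [x * P], hence [P]. *)
Lemma orthogonal_dvd_neg_square (a b c T n x y z P Q R : int) (v q : nat) :
  prime q ->
  a * x ^+ 2 + b * y ^+ 2 + c * z ^+ 2 = a * b * c * (v%:Z * n ^+ 2) ->
  x * P + y * Q + z * R = 0 ->
  b * c * P ^+ 2 + a * c * Q ^+ 2 + a * b * R ^+ 2 = T ->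
  (q %| T)%Z -> ~~ (q %| a * b * c)%Z -> ~~ (q %| n)%Z -> ~~ (q %| x)%Z ->
  ~~ [&& (q %| P)%Z, (q %| Q)%Z & (q %| R)%Z] -> neg_square v q.
Proof.
move=> q_pr EF Eo ET qT qabc qn qx.
have [qR|qR _] := boolP (q %| R)%Z; last first.
  exact: (@orthogonal_complement_dvd a b c T n x y z P Q R).
have [qQ|qQ _] := boolP (q %| Q)%Z; last first.
  apply: (@orthogonal_complement_dvd a c b T n x z y P R Q) => //.
  - by rewrite addrAC EF; ring.
  - by rewrite addrAC.
  - by rewrite -ET; ring.
  - by rewrite mulrAC.
rewrite andbT andbT => /negP[].
suff : (q %| x * P)%Z by rewrite Euclidz_dvdM // (negbTE qx).
have -> : x * P = - (y * Q + z * R).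
  by apply/eqP; rewrite -addr_eq0 addrA Eo.
by rewrite rpredN rpredD // dvdz_mull.
Qed.

Lemma coprime_primes (m n : nat) :
  (forall q, prime q -> (q %| m)%N -> ~~ (q %| n)%N) -> coprime m n.
Proof.
move=> H; rewrite /coprime; case: (ltngtP (gcdn m n) 1) => // [|lt1].
  (* A zero gcd means [m = n = 0], against the hypothesis at the prime 2. *)
  rewrite ltnS leqn0 -leqn0 leqNgt gcdn_gt0 negb_or -!leqNgt !leqn0.
  move=> /andP[/eqP m0 /eqP n0]; by have := H 2 isT; rewrite m0 n0 dvdn0 => /(_ isT).
have := H _ (pdiv_prime lt1).
have := pdiv_dvd (gcdn m n); rewrite dvdn_gcd => /andP[-> ->] /(_ isT).
by [].
Qed.

Lemma odd_sqr_mod8 (q : nat) : odd q -> (q ^ 2 %% 8 = 1)%N.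
Proof.
move=> q_odd; have [t []->] : exists t, q = (4 * t + 1)%N \/ q = (4 * t + 3)%N.
  by exists (q %/ 4)%N; lia.
  have -> : ((4 * t + 1) ^ 2 = (2 * t ^ 2 + t) * 8 + 1)%N by nia.
  by rewrite modnMDl.
have -> : ((4 * t + 3) ^ 2 = (2 * t ^ 2 + 3 * t + 1) * 8 + 1)%N by nia.
by rewrite modnMDl.
Qed.

(** At the primes of [abc] the assumption is [neg_square v q] rather than [v = -1] modulo [q],
    because it has to survive the descent, which may replace [v] by its quotient by a square. *)
Lemma not_represented_core (a b c : int) (v n : nat) (x y z : int) :
  0 < a -> 0 < b -> 0 < c -> (v %% 8 = 7)%N -> (0 < n)%N ->
  (forall q : nat, prime q -> (q %| a * b * c)%Z ->
     ~~ (q %| v)%N /\ neg_square v q) ->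
  a * x ^+ 2 + b * y ^+ 2 + c * z ^+ 2 = a * b * c * (v%:Z * n%:Z ^+ 2) -> False.
Proof.
move=> a_gt0 b_gt0 c_gt0.
have [k] := ubnP (v * n ^ 2)%N.
elim: k v n x y z => // k IH v n x y z; rewrite ltnS => le_k v7 n_gt0 H EF.
have abc0 : a * b * c != 0 by rewrite !mulf_neq0 // gt_eqF.
have v_gt0 : (0 < v)%N by case: (v) v7.
pose g := gcdz (gcdz x y) z.
have g_neq0 : g != 0.
  rewrite /g !gcdz_eq0; apply/negP => /andP[/andP[/eqP x0 /eqP y0] /eqP z0].
  move/esym/eqP: EF; rewrite x0 y0 z0 expr0n /= !mulr0 !addr0; apply/negP.
  by rewrite mulf_neq0 // mulf_neq0 ?expf_neq0 // gt_eqF.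
have qg (q : nat) : [&& (q %| x)%Z, (q %| y)%Z & (q %| z)%Z] = (q %| g)%Z.
  by rewrite /g !dvdz_gcd andbA.
(* Descent: a common prime factor of [x, y, z] not dividing [abc] cancels. *)
have [/hasP [q]|/hasPn gabc] :=
    boolP (has (fun q : nat => ~~ (q %| a * b * c)%Z) (primes `|g|)).
  rewrite mem_primes => /and3P[q_pr _ q_g] qabc.
  have : (q %| g)%Z by rewrite dvdzE.
  rewrite -qg => /and3P[/dvdzP[x' Ex] /dvdzP[y' Ey] /dvdzP[z' Ez]].
  have q0 : q%:Z ^+ 2 != 0 by rewrite expf_neq0 // gt_eqF // ltz_nat prime_gt0.
  have EF' : (a * x' ^+ 2 + b * y' ^+ 2 + c * z' ^+ 2) * q%:Z ^+ 2 =
      a * b * c * (v%:Z * n%:Z ^+ 2).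
    by rewrite -EF Ex Ey Ez; ring.
  have [qn|qn] := boolP (q %| n)%N.
    case/dvdnP: qn => n' En.
    have n'_gt0 : (0 < n')%N by move: n_gt0; rewrite En muln_gt0 => /andP[].
    apply: (IH v n' x' y' z') => //.
      apply: leq_trans le_k; rewrite ltn_pmul2l // En expnMn.
      by rewrite ltn_Pmulr ?expn_gt0 ?n'_gt0 // -{1}(exp1n 2) ltn_exp2r // prime_gt1.
    apply: (mulIf q0); rewrite EF' En PoszM; ring.
  (* Now [q] divides neither [abc] nor [n], so [q ^ 2] divides [v]; the quotient is still 7 modulo 8
     since [q] is odd. *)
  have : (q%:Z ^+ 2 %| a * b * c * (v%:Z * n%:Z ^+ 2))%Z by rewrite -EF' dvdz_mull.
  have coq (m : int) : ~~ (q %| m)%Z -> coprimez (q%:Z ^+ 2) m.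
    by move=> qm; apply: coprimezXl; rewrite coprimezE prime_coprime.
  rewrite Gauss_dvdzr ?coq // Gauss_dvdzl ?coq ?Euclidz_dvdX2 //.
  rewrite dvdzE abszX /= => /dvdnP[v' Ev].
  have v'v : (v' %| v)%N by rewrite Ev dvdn_mulr.
  have q_odd : odd q.
    have : odd v by clear -v7; lia.
    by rewrite Ev oddM oddX => /andP[].
  have v'7 : (v' %% 8 = 7)%N.
    by move: v7; rewrite Ev -modnMmr odd_sqr_mod8 // muln1.
  apply: (IH v' n x' y' z') => //.
    apply: leq_trans le_k; rewrite ltn_pmul2r ?expn_gt0 ?n_gt0 // Ev.
    rewrite ltn_Pmulr //; last by rewrite lt0n; apply/eqP => v0; rewrite v0 in v'7.
    by rewrite -{1}(exp1n 2) ltn_exp2r // prime_gt1.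
  - move=> p p_pr pabc; have [pv [U [W [pW D]]]] := H p p_pr pabc.
    split; first by apply: contra pv => pv'; apply: dvdn_trans v'v.
    (* [v' * (q * W) ^ 2 = v * W ^ 2], and [p] differs from [q] because only [p] divides [abc]. *)
    exists U, (q * W)%N; split; last by rewrite expnMn mulnA -Ev.
    rewrite Euclid_dvdM // negb_or pW andbT dvdn_prime2 //.
    by apply: contra qabc => /eqP <-.
  - by apply: (mulIf q0); rewrite EF' Ev PoszM -mulnn PoszM; ring.
have {gabc} gabc (q : nat) : prime q -> [&& (q %| x)%Z, (q %| y)%Z & (q %| z)%Z] ->
    (q %| a * b * c)%Z.
  move=> q_pr; rewrite qg dvdzE => q_g; apply/negbNE/gabc.
  by rewrite mem_primes q_pr absz_gt0 g_neq0.
have [u1 [u2 E1]] := Bezoutz (a * x) (b * y).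
have [w1 [w2 E2]] := Bezoutz (gcdz (a * x) (b * y)) (c * z).
set h := gcdz _ (c * z) in E2.
pose y1 := w1 * u1; pose y2 := w1 * u2; pose y3 := w2.
(* [(y1, y2, y3)] has inner product [h] with [(x, y, z)], and [(P, Q, R)] is the
   cross product of the two. *)
have EB : a * x * y1 + b * y * y2 + c * z * y3 = h.
  by rewrite -E2 -E1 /y1 /y2 /y3; ring.
have h_prime (q : nat) : prime q -> (q %| h)%Z -> (q %| a * b * c)%Z.
  move=> q_pr; rewrite /h !dvdz_gcd => /andP[/andP[]].
  rewrite !Euclidz_dvdM //; case: (boolP (q %| a)%Z) => //= qa.
  case: (boolP (q %| b)%Z) => //= qb; case: (boolP (q %| c)%Z) => //= qc qx qy qz.
  have := gabc q q_pr; rewrite qx qy qz => /(_ isT).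
  by rewrite !Euclidz_dvdM // (negbTE qa) (negbTE qb) (negbTE qc).
have co_vh : coprime v `|h|.
  apply: coprime_primes => q q_pr qv; apply/negP => q_h.
  have [] := H q q_pr (h_prime q q_pr _); first by rewrite dvdzE.
  by rewrite qv.
pose P := y * y3 - z * y2; pose Q := z * y1 - x * y3; pose R := x * y2 - y * y1.
pose f3 := a * y1 ^+ 2 + b * y2 ^+ 2 + c * y3 ^+ 2.
(* Lagrange's identity. *)
have ET : b * c * P ^+ 2 + a * c * Q ^+ 2 + a * b * R ^+ 2 + h ^+ 2 =
    a * b * c * (v%:Z * n%:Z ^+ 2) * f3.
  by rewrite -EF -EB /P /Q /R /f3; ring.
have Eo : x * P + y * Q + z * R = 0 by rewrite /P /Q /R; ring.
(* Dividing the cross product by its content [t] makes it primitive and changes the value of the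
   form only by the square [t ^ 2]. *)
pose t := gcdz (gcdz P Q) R.
have vD : (v%:Z %| b * c * P ^+ 2 + a * c * Q ^+ 2 + a * b * R ^+ 2 + h ^+ 2)%Z.
  by rewrite ET dvdz_mulr // dvdz_mull // dvdz_mulr.
(* A zero cross product would make [v] divide [h ^ 2], to which it is coprime, so that [v = 1]. *)
have t_neq0 : t != 0.
  rewrite /t !gcdz_eq0; apply/negP => /andP[/andP[/eqP P0 /eqP Q0] /eqP R0].
  move: vD; rewrite P0 Q0 R0 expr0n /= !mulr0 !add0r dvdzE abszX /=.
  have : coprime v (`|h| ^ 2) by rewrite coprimeXr.
  by rewrite /coprime => /eqP + /gcdn_idPl v1; rewrite v1 => Ev; move: v7; rewrite Ev.
have tE d : (d %| t)%Z = [&& (d %| P)%Z, (d %| Q)%Z & (d %| R)%Z].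
  by rewrite /t !dvdz_gcd andbA.
have := dvdzz t; rewrite tE => /and3P[/dvdzP[P' EP] /dvdzP[Q' EQ] /dvdzP[R' ER]].
clearbody t P Q R.
pose T := b * c * P' ^+ 2 + a * c * Q' ^+ 2 + a * b * R' ^+ 2.
have ETt : b * c * P ^+ 2 + a * c * Q ^+ 2 + a * b * R ^+ 2 = T * t ^+ 2.
  by rewrite /T EP EQ ER; ring.
have Eo' : x * P' + y * Q' + z * R' = 0.
  by apply: (mulIf t_neq0); rewrite mul0r -Eo EP EQ ER; ring.
have PQR1 (q : nat) : prime q -> ~~ [&& (q %| P')%Z, (q %| Q')%Z & (q %| R')%Z].
  move=> q_pr; apply/negP => /and3P[qP qQ qR].
  have : (q%:Z * t %| t)%Z.
    by rewrite tE EP EQ ER !dvdz_mul2r ?qP ?qQ.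
  rewrite -{1}[t]mul1r dvdz_mul2r // dvdzE /= dvdn1 => /eqP q1.
  by move: q_pr; rewrite q1.
have T_ge0 : 0 <= T.
  have pos d e w : 0 < d -> 0 < e -> 0 <= d * e * w ^+ 2 :> int.
    by move=> d_gt0 e_gt0; rewrite mulr_ge0 ?sqr_ge0 // mulr_ge0 // ltW.
  by rewrite /T !addr_ge0 ?pos.
have T_neq0 : T != 0.
  apply/negP => /eqP T0.
  have : coprime v (`|h| ^ 2) by rewrite coprimeXr.
  move: vD; rewrite ETt T0 mul0r add0r dvdzE abszX /= /coprime => /gcdn_idPl -> /eqP v1.
  by move: v7; rewrite v1.
apply: (@no_negative_square v `|T| `|t| `|h|) => //.
- by rewrite absz_gt0.
- rewrite ETt dvdzE in vD.
  suff E : (`|T| * `|t| ^ 2 + `|h| ^ 2)%N = T * t ^+ 2 + h ^+ 2 :> int.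
    by move: vD; rewrite -E.
  by rewrite PoszD PoszM -!mulnn !PoszM !abszE -!expr2 !real_normK ?num_real // ger0_norm.
move=> q q_pr qT.
have {}qT : (q %| T)%Z by rewrite dvdzE.
have [qabc|qabc] := boolP (q %| a * b * c)%Z; first by have [] := H q q_pr qabc.
(* Otherwise Lagrange's identity makes [q] divide [h ^ 2], and all prime factors of [h] divide
   [abc]. *)
have qn : ~~ (q %| n%:Z)%Z.
  apply: contra qabc => qn; apply: h_prime => //.
  rewrite -Euclidz_dvdX2 // -[h ^+ 2](addKr (T * t ^+ 2)).
  rewrite rpredD ?rpredN; [by []|exact: dvdz_mulr|rewrite -ETt ET dvdz_mulr //].
  by rewrite dvdz_mull // dvdz_mull // expr2 dvdz_mulr.
(* Some coordinate of [(x, y, z)] is prime to [q]; permuting the coordinates brings it to the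
   front. *)
have: ~~ [&& (q %| x)%Z, (q %| y)%Z & (q %| z)%Z] by apply: contra qabc; exact: gabc.
have := PQR1 q q_pr; rewrite !negb_and => PQRn /or3P[qx|qy|qz].
- by apply: (@orthogonal_dvd_neg_square a b c T n x y z P' Q' R'); rewrite ?negb_and.
- apply: (@orthogonal_dvd_neg_square b a c T n y x z Q' P' R'); rewrite ?negb_and //.
  + by rewrite [b * _ + _]addrC EF; ring.
  + by rewrite [y * _ + _]addrC.
  + by rewrite /T; ring.
  + by rewrite [b * a]mulrC.
  + by rewrite orbCA.
- apply: (@orthogonal_dvd_neg_square c b a T n z y x R' Q' P'); rewrite ?negb_and //.
  + have -> : c * b * a = a * b * c by ring.
    by rewrite -EF; ring.
  + by rewrite -Eo'; ring.
  + by rewrite /T; ring.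
  + by have -> : c * b * a = a * b * c by ring.
  + by case/or3P: PQRn => ->; rewrite ?orbT.
Qed.

(** * Rational forms *)

Lemma not_represented (a b c v : int) (w : rat) :
  0 < a -> 0 < b -> 0 < c -> w != 0 -> (8 %| v + 1)%Z ->
  (forall q : nat, prime q -> (q %| a * b * c)%Z -> (q %| v + 1)%Z) ->
  ~ represented a%:Q b%:Q c%:Q ((a * b * c)%:Q * v%:Q * w ^+ 2).
Proof.
move=> a_gt0 b_gt0 c_gt0 w0 v8 Hq [x [y [z E]]].
have abc_gt0 : 0 < a * b * c by rewrite !mulr_gt0.
(* The form is nonnegative, so a represented value forces the sign of [v]. *)
have v_ge0 : 0 <= v.
  suff : 0 <= (a * b * c)%:Q * v%:Q * w ^+ 2.
    rewrite pmulr_lge0 ?exprn_even_gt0 //.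
    by rewrite pmulr_rge0 ?ltr0z // ler0z.
  by rewrite -E !addr_ge0 // mulr_ge0 ?sqr_ge0 // ler0z ltW.
have Ev : v = `|v|%N :> int by rewrite gez0_abs.
pose den := (denq x * denq y * denq z * denq w)%R.
pose x' := numq x * (denq y * denq z * denq w).
pose y' := numq y * (denq x * denq z * denq w).
pose z' := numq z * (denq x * denq y * denq w).
pose w' := numq w * (denq x * denq y * denq z).
have Ex : x'%:Q = x * den%:Q by rewrite !rmorphM /= numqE; ring.
have Ey : y'%:Q = y * den%:Q by rewrite !rmorphM /= numqE; ring.
have Ez : z'%:Q = z * den%:Q by rewrite !rmorphM /= numqE; ring.
have Ew : w'%:Q = w * den%:Q by rewrite !rmorphM /= numqE; ring.
have w'0 : w' != 0 by rewrite /w' !mulf_neq0 ?denq_neq0 // numq_eq0.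
clearbody x' y' z' w'.
have EF : a * x' ^+ 2 + b * y' ^+ 2 + c * z' ^+ 2 = a * b * c * (v * w' ^+ 2).
  apply: (@intr_inj rat); rewrite !(rmorphD, rmorphM, rmorphXn) /= Ex Ey Ez Ew.
  transitivity ((a * b * c)%:Q * v%:Q * w ^+ 2 * den%:Q ^+ 2).
    by rewrite -E; ring.
  by rewrite !rmorphM /=; ring.
apply: (@not_represented_core a b c `|v| `|w'| x' y' z') => //.
- by move: v8 v_ge0; clear; lia.
- by rewrite absz_gt0.
- move=> q q_pr qabc; have := Hq q q_pr qabc; rewrite Ev => qv; split.
    by apply/negP => qv'; move: qv; rewrite dvdzE /= dvdn_addr // Euclid_dvd1.
  by exists 1%N, 1%N; rewrite Euclid_dvd1 // muln1 addnC.
- by rewrite EF -Ev abszE real_normK ?num_real.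
Qed.

(** [q] divides the numerator of [u], hence is prime to its denominator, and [q ^ 2] passes from the
    squared numerator to [m]. *)
Lemma square_dvd (m : int) (u : rat) (q : nat) :
  prime q -> m%:Q = u ^+ 2 -> (q %| m)%Z -> (q%:Z ^+ 2 %| m)%Z.
Proof.
move=> q_pr Em qm.
have E : m * denq u ^+ 2 = numq u ^+ 2.
  apply: (@intr_inj rat); rewrite !(rmorphM, rmorphXn) /= numqE Em; ring.
have qnum : (q %| numq u)%Z by rewrite -Euclidz_dvdX2 // -E dvdz_mulr.
have : (q%:Z ^+ 2 %| m * denq u ^+ 2)%Z by rewrite E dvdz_exp2r.
rewrite Gauss_dvdzl //; apply/coprimezXl/coprimezXr.
by rewrite coprimezE; apply: coprime_dvdl (coprime_num_den u).
Qed.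

(** Otherwise [q ^ 2], which divides the whole product by [square_dvd], would already divide the
    square-free [d * m1]. *)
Lemma squarefree_dvd_square (d m1 m2 m3 S : int) (u : rat) (q : nat) :
  prime q -> squarefreez (d * m1) -> (d * (m1 * m2 * m3) * S)%:Q = u ^+ 2 ->
  (q %| m1)%Z -> [|| (q %| m2)%Z, (q %| m3)%Z | (q %| S)%Z].
Proof.
move=> q_pr sqf E qm1; apply/negP => /negP; rewrite !negb_or => /and3P[q2 q3 qS].
have qK : (q %| d * (m1 * m2 * m3) * S)%Z.
  by rewrite !Euclidz_dvdM // qm1 !(orbT, orTb).
have := square_dvd q_pr E qK.
have coq (m : int) : ~~ (q %| m)%Z -> coprimez (q%:Z ^+ 2) m.
  by move=> qm; apply: coprimezXl; rewrite coprimezE prime_coprime.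
have -> : d * (m1 * m2 * m3) * S = d * m1 * m2 * m3 * S by ring.
do 3![rewrite Gauss_dvdzl ?coq //]; move=> /sqf.
by case/orP=> /eqP /(congr1 absz) /= q1; rewrite q1 in q_pr.
Qed.

(** Rescaling the variables by [r], [s], [t] and dividing by [d] leaves the form with coefficients
    [a2], [b2], [c2]. As [d * (a2 * b2 * c2) * S] is a rational square, a prime dividing one of
    these coefficients divides another one, hence some [d_i], or else [S]. *)
Lemma attached_gcds_primes (a b c R : rat) (S d1 d2 d3 : int) :
  0 < a -> 0 < b -> 0 < c -> a * b * c = R ^+ 2 * S%:Q ->
  attached_gcds a b c d1 d2 d3 ->
  exists (a2 b2 c2 : int) (w : rat),
  [/\ [/\ 0 < a2, 0 < b2 & 0 < c2], w != 0,
      forall q : nat, prime q -> (q %| a2 * b2 * c2)%Z ->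
        (q %| d1 * d2 * d3 * S)%Z
    & forall n, represented a b c (S%:Q * n) ->
        represented a2%:Q b2%:Q c2%:Q ((a2 * b2 * c2)%:Q * n * w ^+ 2)].
Proof.
move=> a_gt0 b_gt0 c_gt0 ES [r [s [t [a1 [b1 [c1 [a2 [b2 [c2]]]]]]]]] /=.
set d := gcdz _ c1 => - [[sa sb sc] [Ea Eb Ec] [Ea1 Eb1 Ec1] [-> -> ->]].
have part_gt0 (e f : rat) (m : int) : 0 < e -> e = f ^+ 2 * m%:Q -> f != 0 /\ 0 < m.
  move=> e_gt0 E; have f0 : f != 0.
    by apply: contraTneq e_gt0 => f0; rewrite E f0 expr0n mul0r ltxx.
  by split=> //; move: e_gt0; rewrite E pmulr_rgt0 ?exprn_even_gt0 // ltr0z.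
have [r0 a1_gt0] := part_gt0 _ _ _ a_gt0 Ea.
have [s0 b1_gt0] := part_gt0 _ _ _ b_gt0 Eb.
have [t0 c1_gt0] := part_gt0 _ _ _ c_gt0 Ec.
have d_ge0 : 0 <= d by rewrite /d /gcdz.
clearbody d.
have d_gt0 : 0 < d.
  rewrite lt_neqAle d_ge0 andbT eq_sym; apply: contraTneq a1_gt0 => d0.
  by rewrite Ea1 d0 mul0r ltxx.
have a2_gt0 : 0 < a2 by move: a1_gt0; rewrite Ea1 pmulr_rgt0.
have b2_gt0 : 0 < b2 by move: b1_gt0; rewrite Eb1 pmulr_rgt0.
have c2_gt0 : 0 < c2 by move: c1_gt0; rewrite Ec1 pmulr_rgt0.
have RS0 : R ^+ 2 * S%:Q != 0 by rewrite -ES !mulf_neq0 ?gt_eqF.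
have [R0 S0] : R != 0 /\ S%:Q != 0.
  by move: RS0; rewrite mulf_eq0 expf_eq0 /= negb_or => /andP[].
have dQ0 : d%:Q != 0 by rewrite intr_eq0 gt_eqF.
have abc2 : a * b * c = (r * s * t * d%:Q) ^+ 2 * (d%:Q * (a2 * b2 * c2)%:Q).
  by rewrite Ea Eb Ec Ea1 Eb1 Ec1 !rmorphM /=; ring.
(* Comparing [ES] with [abc2] gives [S / d = a2 * b2 * c2 * w ^ 2] for this [w]. *)
exists a2, b2, c2, (r * s * t * d%:Q / R); split=> //.
- by rewrite !mulf_neq0 ?invr_eq0.
- move=> q q_pr qabc; apply: contraT => nq.
  have sq : exists u, (d * (a2 * b2 * c2) * S)%:Q = u ^+ 2.
    (* By [ES], [a * b * c * S] is the square of [R * S]; divide by the square factor in [abc2]. *)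
    exists (R * S%:Q / (r * s * t * d%:Q)).
    apply: (mulfI (_ : (r * s * t * d%:Q) ^+ 2 != 0)).
      by rewrite expf_neq0 // !mulf_neq0.
    rewrite rmorphM /= rmorphM mulrA -abc2 ES; field.
    by rewrite r0 s0 t0 dQ0.
  case: sq => u sq.
  move: nq; rewrite !Euclidz_dvdM // !negb_or !dvdz_gcd => /andP[/andP[/andP[n1 n2] n3] nS].
  move: qabc; rewrite !Euclidz_dvdM // => /orP[/orP[qa|qb]|qc].
  + have := @squarefree_dvd_square d a2 b2 c2 S u q q_pr; rewrite -Ea1 sq qa.
    by move: n1 n2; rewrite qa (negbTE nS) => /= /negbTE-> /negbTE-> /(_ sa erefl isT).
  + have := @squarefree_dvd_square d b2 a2 c2 S u q q_pr.
    rewrite -Eb1 [b2 * a2]mulrC sq qb.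
    by move: n1 n3; rewrite qb andbT (negbTE nS) => /= /negbTE-> /negbTE-> /(_ sb erefl isT).
  + have := @squarefree_dvd_square d c2 a2 b2 S u q q_pr.
    rewrite -Ec1 -[c2 * a2 * b2]mulrA [c2 * (_ * _)]mulrC sq qc.
    by move: n2 n3; rewrite qc !andbT (negbTE nS) => /= /negbTE-> /negbTE-> /(_ sc erefl isT).
move=> n [x [y [z E]]]; exists (r * x), (s * y), (t * z).
apply: (mulfI dQ0).
transitivity (a * x ^+ 2 + b * y ^+ 2 + c * z ^+ 2).
  by rewrite Ea Eb Ec Ea1 Eb1 Ec1 !rmorphM /=; ring.
rewrite E; apply: (mulfI (_ : R ^+ 2 != 0)); first by rewrite expf_neq0.
rewrite [LHS]mulrA -ES abc2; field.
exact: R0.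
Qed.

Theorem corollary10 :
  (forall (a b c R : rat) (S d1 d2 d3 : int),
     0 < a -> 0 < b -> 0 < c ->
     squarefreez S -> a * b * c = R ^+ 2 * S%:Q ->
     attached_gcds a b c d1 d2 d3 ->
     forall N : int,
       (N = - S %[mod 8 * d1 * d2 * d3 * S ^+ 2])%Z ->
       ~ represented a b c N%:Q)
  /\
  (forall (a b c : int) (R : rat) (S : int),
     0 < a -> 0 < b -> 0 < c ->
     squarefreez S -> a%:Q * b%:Q * c%:Q = R ^+ 2 * S%:Q ->
     forall N : int,
       (N = - S %[mod 8 * a * b * c * S])%Z ->
       ~ represented a%:Q b%:Q c%:Q N%:Q)
  /\
  (forall a b c : int,
     0 < a -> 0 < b -> 0 < c ->
     forall N : int,
       (N = - (a * b * c) %[mod 8 * (a * b * c) ^+ 2])%Z ->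
       ~ represented a%:Q b%:Q c%:Q N%:Q).
Proof.
(* All three moduli have the shape [S * (8 * m)], with [a * b * c] in place of [S] in the last
   statement. *)
have mod_eq (N S m : int) : (N = - S %[mod S * (8 * m)])%Z ->
    exists2 v, N = S * v & (8 %| v + 1)%Z /\ (m %| v + 1)%Z.
  move=> /eqP; rewrite eqz_mod_dvd opprK => /dvdzP[k E].
  exists (k * (8 * m) - 1); first by rewrite -[N](addrK S) E; ring.
  by rewrite subrK; split; apply: dvdz_mull; [apply: dvdz_mulr | apply: dvdz_mull].
split=> [a b c R S d1 d2 d3 a_gt0 b_gt0 c_gt0 _ ES|].
  move=> /(attached_gcds_primes a_gt0 b_gt0 c_gt0 ES).
  move=> [a2 [b2 [c2 [w [[a2_gt0 b2_gt0 c2_gt0] w0 Hq Hrep]]]]] N.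
  have -> : 8 * d1 * d2 * d3 * S ^+ 2 = S * (8 * (d1 * d2 * d3 * S)) by ring.
  case/mod_eq => v -> [v8 vm]; rewrite rmorphM /= => /Hrep.
  by apply: not_represented => // q q_pr /(Hq _ q_pr) qm; apply: dvdz_trans vm.
split=> [a b c R S a_gt0 b_gt0 c_gt0 _ ES N|a b c a_gt0 b_gt0 c_gt0 N].
  have -> : 8 * a * b * c * S = S * (8 * (a * b * c)) by ring.
  case/mod_eq => v -> [v8 vm].
  have R0 : R != 0.
    apply/eqP => R0; move/eqP: ES; rewrite R0 expr0n mul0r /=; apply/negP.
    by rewrite !mulf_neq0 // intr_eq0 gt_eqF.
  have -> : (S * v)%:Q = (a * b * c)%:Q * v%:Q * R^-1 ^+ 2.
    by rewrite !rmorphM /= ES; field.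
  apply: not_represented => // [|q _ qabc]; first by rewrite invr_eq0.
  exact: dvdz_trans vm.
have -> : 8 * (a * b * c) ^+ 2 = (a * b * c) * (8 * (a * b * c)) by ring.
case/mod_eq => v -> [v8 vm].
have -> : (a * b * c * v)%:Q = (a * b * c)%:Q * v%:Q * 1 ^+ 2.
  by rewrite expr1n mulr1 rmorphM.
by apply: not_represented => // q _ qabc; apply: dvdz_trans vm.
Qed.
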